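(* Let $k\ge 1$ and let $G_1,\ldots,G_l$ be $k$-symmetric graphs. Let $G=G_1\vee_k\cdots\vee_k G_l$ be a $k$-symmetric join of $G_1,\ldots,G_l$ (for any choice of $k$-symmetric automorphisms $\varphi_i$ of $G_i$ and bases $B_i$ of $\varphi_i$), and let $n=|V(G)|/k$. Then $m_G(n)\ge l-1$.
   Context: A finite simple graph $G$ is $k$-symmetric if $\mathrm{Aut}(G)$ contains a subgroup isomorphic to $\mathbb{Z}_k$ acting freely on $V(G)$; a generator $\varphi$ of such a subgroup is a $k$-symmetric automorphism. A base of $\varphi$ is a minimal subset $B\subseteq V(G)$ with $\bigcup_{i=0}^{k-1}\varphi^i(B)=V(G)$ (i.e. a set containing exactly one vertex from each orbit), so $|B|=|V(G)|/k$. The $k$-symmetric join $G_1\vee_k\cdots\vee_k G_l$, given $k$-symmetric automorphisms $\varphi_i$ of $G_i$ with chosen bases $B_i$, is the graph obtained from the disjoint union $G_1\cup\cdots\cup G_l$ by adding, for every $j\in\mathbb{Z}_k$ and every pair $i\ne i'$, all edges between vertices of $\varphi_i^j(B_i)$ and vertices of $\varphi_{i'}^j(B_{i'})$. The Laplacian matrix is $L(G)=D(G)-A(G)$ and $m_G(\lambda)$ is the multiplicity of $\lambda$ as an eigenvalue of $L(G)$. *)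

(* Defs.v *)
From HB Require Import structures.
From mathcomp Require Import all_boot all_order all_algebra all_fingroup all_solvable.
Set Implicit Arguments.
Unset Strict Implicit.
Unset Printing Implicit Defensive.
Import Order.TTheory GRing.Theory Num.Theory GroupScope.
Local Open Scope ring_scope.

Record sgraph := SGraph {
  vertex :> finType;
  edge : rel vertex;
  edge_sym : symmetric edge;
  edge_irrefl : irreflexive edge
}.

Definition graph_aut_set (G : sgraph) : {set {perm G}} :=
  [set s : {perm G} | [forall x, forall y, edge (s x) (s y) == edge x y]].

Lemma graph_aut_group_set (G : sgraph) : group_set (graph_aut_set G).
Proof.
apply/group_setP; split.
  by rewrite inE; apply/forallP => x; apply/forallP => y; rewrite !perm1.
move=> s t; rewrite !inE => /forallP sP /forallP tP.
apply/forallP => x; apply/forallP => y; rewrite !permM.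
by rewrite (eqP (forallP (tP _) _)); apply: (forallP (sP x)).
Qed.

Definition graph_aut (G : sgraph) : {group {perm G}} :=
  Group (graph_aut_group_set G).

(* The action is free when all point stabilisers are trivial. [Zp k] is a
   cyclic group of order k for every k >= 1 (also for k = 1, where the ring
   ['Z_k] itself has two elements). *)
Definition free_cyclic_subgroup (k : nat) (G : sgraph)
    (H : {group {perm G}}) : Prop :=
  [/\ H \subset graph_aut G, H \isog Zp k
    & forall x : G, 'C_H[x | 'P]%g = 1%g].

Definition k_symmetric (k : nat) (G : sgraph) : Prop :=
  exists H : {group {perm G}}, free_cyclic_subgroup k H.

Definition k_symmetric_aut (k : nat) (G : sgraph) (phi : {perm G}) : Prop :=
  exists2 H : {group {perm G}}, free_cyclic_subgroup k H & generator H phi.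

Definition is_base (k : nat) (G : sgraph) (phi : {perm G}) (B : {set G}) : bool :=
  minset [pred C : {set G} |
           \bigcup_(j < k) [set (phi ^+ j)%g x | x in C] == [set: G]] B.

Section Join.
Variables (k l : nat) (G : 'I_l -> sgraph).
Variables (phi : forall i, {perm G i}) (B : forall i, {set G i}).

Definition join_vertex : finType := {i : 'I_l & G i}.

Definition in_translate (j : nat) (u : join_vertex) : bool :=
  tagged u \in [set (phi (tag u) ^+ j)%g x | x in B (tag u)].

Definition join_edge : rel join_vertex := fun u v =>
  if tag u == tag v then edge (tagged u) (tagged_as u v)
  else [exists j : 'I_k, in_translate j u && in_translate j v].

Lemma join_edge_sym : symmetric join_edge.
Proof.
move=> [i x] [i' y]; rewrite /join_edge /=.
case: (eqVneq i i') => [eq_i | ne_i].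
  by case: _ / eq_i y => y; rewrite ?eqxx !tagged_asE edge_sym.
by rewrite ?(eq_sym i') ?(negPf ne_i); apply: eq_existsb => j; rewrite andbC.
Qed.

Lemma join_edge_irrefl : irreflexive join_edge.
Proof. by move=> [i x]; rewrite /join_edge /= eqxx tagged_asE edge_irrefl. Qed.

Definition k_join : sgraph := SGraph join_edge_sym join_edge_irrefl.

End Join.

Section Laplacian.
Variables (R : realFieldType) (G : sgraph).

Definition degree (x : G) : nat := #|[set y | edge x y]|.

Definition adjacency_mx : 'M[R]_#|G| :=
  \matrix_(i, j) (edge (enum_val i) (enum_val j))%:R.

Definition degree_mx : 'M[R]_#|G| :=
  diag_mx (\row_i (degree (enum_val i))%:R).

Definition laplacian : 'M[R]_#|G| := degree_mx - adjacency_mx.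

(* Geometric multiplicity; the Laplacian is symmetric over an ordered field, so
   this is also the multiplicity as a root of the characteristic polynomial. *)
Definition laplacian_mult (a : R) : nat := \rank (eigenspace laplacian a).

End Laplacian.

(* Main.v *)
Require Import Defs.
From mathcomp Require Import all_boot all_order all_algebra all_fingroup all_solvable.
Import GRing.Theory.
Local Open Scope ring_scope.

(** Every vertex of [G_i] lies in exactly one translate of [B_i], so a vertex
    outside [G_i] has exactly [m_i = |B_i|] neighbours in [G_i]. Hence the
    Laplacian maps the vector equal to [c_i] on [G_i] to the one equal to
    [n c_i - \sum_i' m_i' c_i'] on [G_i], where [n = \sum_i m_i]: the
    hyperplane [\sum_i m_i c_i = 0] consists of eigenvectors for [n]. *)

Lemma leq_laplacian_mult_equitable (R : realFieldType) (G : sgraph) (l : nat)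
    (part : G -> 'I_l) (m : 'I_l -> nat) (rep : 'I_l -> G) :
  cancel rep part ->
  (forall u i, i != part u -> #|[set v | part v == i & edge u v]| = m i) ->
  (l - 1 <= laplacian_mult G ((\sum_i m i)%:R : R))%N.
Proof.
move=> repK m_nbr.
(* Row [i] of [P] is the indicator of part [i], so [c *m P] takes the value [c_i] on part [i]; the
   hyperplane of the [c] with [c *m N = 0] is [kermx N]. *)
pose P : 'M[R]_(l, #|G|) := \matrix_(i, u) (part (enum_val u) == i)%:R.
pose N : 'cV[R]_l := \col_i (m i)%:R.
have P_free : row_free P.
  (* The right inverse evaluates a vector at the representatives, one in each part. *)
  apply/row_freeP; exists (\matrix_(u, i) (u == enum_rank (rep i))%:R).
  apply/matrixP=> i i'; rewrite !mxE (bigD1 (enum_rank (rep i'))) //=.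
  rewrite big1 => [|u /negPf ne_u]; last by rewrite !mxE ne_u mulr0.
  by rewrite !mxE eqxx mulr1 addr0 enum_rankK repK eq_sym.
have PL : P *m laplacian R G = (\sum_i m i)%:R *: P - N *m const_mx 1.
  apply/matrixP=> i u; rewrite mulmxBr !mxE big_ord1 !mxE mulr1.
  have -> : \sum_j P i j * degree_mx R G j u
            = (part (enum_val u) == i)%:R * (degree (enum_val u))%:R.
    rewrite (bigD1 u) //= big1 => [|v /negPf ne_v]; last by rewrite !mxE ne_v mulr0.
    by rewrite !mxE eqxx mulr1n addr0.
  have -> : \sum_j P i j * adjacency_mx R G j u
            = #|[set v | part v == i & edge (enum_val u) v]|%:R.
    rewrite -sum1_card natr_sum (reindex (@enum_rank G)) /=; last first.
      by exists enum_val => v _; rewrite ?enum_rankK ?enum_valK.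
    rewrite [RHS]big_mkcond; apply: eq_bigr => v _.
    rewrite !mxE enum_rankK inE edge_sym.
    by case: eqP; case: edge; rewrite /= ?mul1r ?mul0r.
  move: (enum_val u) => {}u; have [<-|ne_i] := eqVneq (part u) i; last first.
    by rewrite !mul0r mulr0 !sub0r m_nbr // eq_sym.
  (* For [u] in part [i], both sides reduce to the sum of [m j] over the other parts [j]: on the
     left the neighbours inside the part cancel from the degree. *)
  rewrite mul1r mulr1 (bigD1 (part u)) //= natrD addrAC subrr add0r.
  have -> : degree u = (\sum_i #|[set v | part v == i & edge u v]|)%N.
    rewrite /degree -sum1_card (partition_big part xpredT) //=.
    apply: eq_bigr => j _; rewrite -sum1_card; apply: eq_bigl => v.
    by rewrite !inE andbC.
  rewrite (bigD1 (part u)) //= natrD addrAC subrr add0r.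
  by congr _%:R; apply: eq_bigr => j ne_j; rewrite m_nbr.
have sub_eigen : (kermx N *m P <= eigenspace (laplacian R G) (\sum_i m i)%:R)%MS.
  apply/eigenspaceP; rewrite -mulmxA PL mulmxBr mulmxA mulmx_ker mul0mx subr0.
  by rewrite -scalemxAr.
apply: leq_trans (mxrankS sub_eigen).
(* [N] has a single column, so its rank is at most 1. *)
by rewrite mxrankMfree // mxrank_ker leq_sub2l // rank_leq_col.
Qed.

Section Base.
Variables (k : nat) (G : sgraph) (phi : {perm G}) (B : {set G}).
Hypotheses (k_gt0 : (0 < k)%N) (phiP : k_symmetric_aut k phi).
Hypothesis (B_base : is_base k phi B).

Let translate (j : nat) : {set G} := [set (phi ^+ j)%g x | x in B].

Lemma order_k_symmetric_aut : #[phi]%g = k.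
Proof.
case: phiP => H [_ isoH _] /eqP genH.
by rewrite /order -genH (card_isog isoH) card_Zp.
Qed.

(** The quotient of the two powers fixes [x], so it is trivial by freeness, and [phi] has order
    [k]. *)
Lemma k_symmetric_aut_free i j x :
  (phi ^+ i)%g x = (phi ^+ j)%g x -> i = j %[mod k].
Proof.
case: phiP => H [_ isoH freeH] /eqP genH eq_ij; apply/eqP.
rewrite -order_k_symmetric_aut -eq_expg_mod_order.
suff: (phi ^+ i * (phi ^+ j)^-1)%g \in 'C_H[x | 'P]%g.
  by rewrite freeH inE -eq_mulgV1.
have phiH : phi \in H by rewrite genH cycle_id.
rewrite inE groupM ?groupV ?groupX //=; apply/astab1P; rewrite /= apermE permM.
by rewrite eq_ij permK.
Qed.

Lemma base_cover x : exists j : 'I_k, x \in translate j.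
Proof.
have /minsetP[/= /eqP cover _] := B_base.
have: x \in [set: G] by [].
by rewrite -cover => /bigcupP[j _ xj]; exists j.
Qed.

(** If [x] came from distinct base points [b] and [c], then [c] would lie in the orbit of [b], and
    removing it from [B] would leave a cover, against minimality. With [b = c], freeness applies. *)
Lemma base_translate_inj (i j : 'I_k) x :
  x \in translate i -> x \in translate j -> i = j.
Proof.
case/imsetP=> b bB -> /imsetP[c cB] eq_bc.
suff eq_b : b = c.
  move: eq_bc; rewrite -eq_b => /k_symmetric_aut_free.
  by rewrite !modn_small // => /val_inj.
apply/eqP/negPn/negP => ne_bc.
have /minsetP[/= /eqP cover minB] := B_base.
suff eqB : B :\ c = B by move: cB; rewrite -eqB !inE eqxx.
apply: minB; last exact: subsetDl.
(* The exponent stands for [i - j] modulo [k], kept in the naturals. *)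
have c_b : c = (phi ^+ (i + (k - j)))%g b.
  rewrite expgD permM eq_bc -permM -expgD subnKC 1?ltnW //.
  by rewrite -order_k_symmetric_aut expg_order perm1.
apply/eqP/setP=> y; rewrite inE; apply/bigcupP.
have [m /imsetP[d dB ->]] := base_cover y.
have [->|ne_dc] := eqVneq d c; last first.
  by exists m => //; apply: imset_f; rewrite !inE ne_dc.
exists (Ordinal (ltn_pmod (i + (k - j) + m) k_gt0)) => //=.
rewrite [in X in X \in _]c_b -permM -expgD -[in X in (_ %% X)%N]order_k_symmetric_aut expg_mod_order.
by apply: imset_f; rewrite !inE ne_bc.
Qed.

Lemma card_base_translate j : #|translate j| = #|B|.
Proof. by rewrite card_imset //; apply: perm_inj. Qed.

(** Double counting of the pairs of a vertex and a translate containing it. *)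
Lemma card_base : #|G| = (k * #|B|)%N.
Proof.
rewrite -cardsT -sum1_card.
transitivity (\sum_(x : G) \sum_(j < k | x \in translate j) 1)%N.
  rewrite big_mkcond; apply: eq_bigr => x _; rewrite inE.
  have [j xj] := base_cover x; rewrite (big_pred1 j) // => i.
  by apply/idP/eqP => [xi|-> //]; apply: base_translate_inj xi xj.
rewrite (exchange_big_dep xpredT) //= (eq_bigr (fun=> #|B|)) => [|j _].
  by rewrite sum_nat_const card_ord.
by rewrite sum1_card card_base_translate.
Qed.

End Base.

Section Join.
Variables (k l : nat) (G : 'I_l -> sgraph).
Variables (phi : forall i, {perm G i}) (B : forall i, {set G i}).
Hypothesis (k_gt0 : (0 < k)%N).
Hypothesis (phiP : forall i, k_symmetric_aut k (phi i)).
Hypothesis (B_base : forall i, is_base k (phi i) (B i)).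

Let J := k_join k phi B.

Lemma card_k_join : #|J| = (k * \sum_i #|B i|)%N.
Proof.
rewrite card_tagged sumnE big_map big_enum big_distrr /=.
by apply: eq_bigr => i _; apply: card_base.
Qed.

Lemma Tagged_inj i : injective (fun x : G i => Tagged G x : J).
Proof. by move=> x y /eqP; rewrite -tag_eqE /tag_eq /= eqxx tagged_asE => /eqP. Qed.

(** The vertex [u] lies in the translate of a unique index [j], so its neighbours in [G i] are
    exactly the [j]-th translate of [B i]. *)
Lemma card_k_join_neighbors (u : J) i :
  i != tag u -> #|[set v : J | tag v == i & edge u v]| = #|B i|.
Proof.
move=> ne_i; have [j uj] := base_cover _ _ _ _ (B_base (tag u)) (tagged u).
rewrite -(card_base_translate _ (phi i) (B i) j) -(card_imset _ (@Tagged_inj i)).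
congr #|pred_of_set _|; apply/setP=> v; rewrite inE; apply/andP/imsetP.
  case: v => i' v /= [/eqP eq_i]; subst i'.
  rewrite /join_edge /= eq_sym (negPf ne_i) => /existsP[j' /andP[uj' vj']].
  exists v => //; have -> // : j = j'.
  by apply: base_translate_inj uj uj'.
case=> x xj ->; split=> //=.
rewrite /join_edge /= eq_sym (negPf ne_i); by apply/existsP; exists j; apply/andP.
Qed.

End Join.

Theorem theorem4p2 (R : realFieldType) (k l : nat) (G : 'I_l -> sgraph)
    (phi : forall i : 'I_l, {perm G i}) (B : forall i : 'I_l, {set G i}) :
  (1 <= k)%N -> (1 <= l)%N ->
  (forall i : 'I_l, (0 < #|G i|)%N) ->
  (forall i : 'I_l, k_symmetric k (G i)) ->
  (forall i : 'I_l, k_symmetric_aut k (phi i)) ->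
  (forall i : 'I_l, is_base k (phi i) (B i)) ->
  let J := k_join k phi B in
  let n : R := #|J|%:R / k%:R in
  (l - 1 <= laplacian_mult J n)%N.
Proof.
move=> k_gt0 _ G_gt0 _ phiP B_base.
cbv zeta; set J := k_join k phi B.
have -> : #|J|%:R / k%:R = (\sum_i #|B i|)%:R :> R.
  by rewrite card_k_join // natrM mulrC mulKf // Num.Theory.pnatr_eq0 -lt0n.
(* The first vertex of each nonempty [G i] represents its part. *)
pose rep i : J := Tagged G (enum_val (Ordinal (G_gt0 i))).
apply: (@leq_laplacian_mult_equitable R J l (fun u : J => tag u) _ rep) => // u i.
exact: card_k_join_neighbors.
Qed.
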